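(* Let $(X,\mathcal{A},\mu)$ be a measure space. Then $\mathcal{M}_\infty(X,\mathcal{A})$ is the closure of $\mathcal{M}_F(X,\mathcal{A})$ in $\mathcal{M}(X,\mathcal{A})$ with respect to the $U_\mu$-topology.
   Context: $X$ is a non-empty set, $\mathcal{A}$ a $\sigma$-algebra on $X$, $\mu:\mathcal{A}\to[0,\infty]$ a measure. $\mathcal{M}(X,\mathcal{A})$ is the commutative ring of all measurable functions $X\to\mathbb{R}$ under pointwise operations. A $\mu$-null set is a set $E\in\mathcal{A}$ with $\mu(E)=0$. The $U_\mu$-topology on $\mathcal{M}(X,\mathcal{A})$ has as open base the sets $U_\mu(f,\epsilon)=\{g\in\mathcal{M}(X,\mathcal{A}): \sup_{x\in X\setminus E}|f(x)-g(x)|<\epsilon$ for some $\mu$-null set $E\}$ (supremum taken in $[0,\infty]$), $f\in\mathcal{M}(X,\mathcal{A})$, $\epsilon>0$. $Z(f)=\{x\in X: f(x)=0\}$. $\mathcal{M}_F(X,\mathcal{A})=\{f\in\mathcal{M}(X,\mathcal{A}): \mu(X\setminus Z(f))<\infty\}$ and $\mathcal{M}_\infty(X,\mathcal{A})=\{f\in\mathcal{M}(X,\mathcal{A}): \mu(\{x\in X:|f(x)|\geq\epsilon\})<\infty$ for all $\epsilon>0\}$. *)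

(* Defs.v *)
From HB Require Import structures.
From mathcomp Require Import all_boot all_order all_algebra.
From mathcomp Require Import all_classical all_reals all_analysis.

Set Implicit Arguments.
Unset Strict Implicit.
Unset Printing Implicit Defensive.

Import Order.TTheory GRing.Theory Num.Theory.

Local Open Scope classical_set_scope.
Local Open Scope ring_scope.

Section Umu.
Context (d : measure_display) (T : measurableType d) (R : realType).
Variable mu : {measure set T -> \bar R}.

Definition null_set (E : set T) : Prop := measurable E /\ mu E = 0%E.

(* Supremum in [0, +oo] of |f - g| outside E. The maximum with 0 only matters
   when E is the whole space: ereal_sup set0 is -oo, but the supremum of the
   empty set in [0, +oo] is 0. *)
Definition sup_dist_off (E : set T) (f g : T -> R) : \bar R :=
  maxe 0%E (ereal_sup [set (`|f x - g x|)%:E | x in ~` E]).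

Definition Umu_ball (f : {mfun T >-> R}) (eps : R) : set {mfun T >-> R} :=
  [set g : {mfun T >-> R} |
    exists E, null_set E /\ (sup_dist_off E f g < eps%:E)%E].

Lemma sup_dist_off_ltP (E : set T) (f g : T -> R) (eps : R) :
  (sup_dist_off E f g < eps%:E)%E <->
  exists r, [/\ 0 <= r, r < eps & forall x, ~ E x -> `|f x - g x| <= r].
Proof.
split.
- move=> lt_eps.
  have ge0 : (0 <= sup_dist_off E f g)%E by rewrite /sup_dist_off le_max lexx.
  have fin : sup_dist_off E f g \is a fin_num.
    by rewrite ge0_fin_numE// (lt_trans lt_eps)// ltry.
  exists (fine (sup_dist_off E f g)); split.
  + exact: fine_ge0.
  + by rewrite -lte_fin fineK.
  + move=> x Ex; rewrite -lee_fin fineK// /sup_dist_off le_max; apply/orP; right.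
    by apply: ereal_sup_ubound; exists x.
- move=> [r [r0 reps fgr]]; apply: (@le_lt_trans _ _ r%:E); last by rewrite lte_fin.
  rewrite /sup_dist_off ge_max lee_fin r0/=.
  by apply: ge_ereal_sup => _ [x Ex <-]; rewrite lee_fin fgr.
Qed.

Lemma null_setU (E F : set T) : null_set E -> null_set F -> null_set (E `|` F).
Proof.
move=> [mE E0] [mF F0]; split; first exact: measurableU.
by rewrite measureU0.
Qed.

Lemma Umu_ball_center (f : {mfun T >-> R}) (eps : R) :
  0 < eps -> Umu_ball f eps f.
Proof.
move=> eps0; exists set0; split; first by split => //; rewrite measure0.
by apply/sup_dist_off_ltP; exists 0; split => // x _; rewrite subrr normr0.
Qed.

Lemma Umu_ball_sub (f h : {mfun T >-> R}) (eps : R) : Umu_ball f eps h ->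
  exists2 del, 0 < del & forall r, r <= del -> Umu_ball h r `<=` Umu_ball f eps.
Proof.
move=> [E [nE /sup_dist_off_ltP[a [a0 aeps fha]]]].
exists (eps - a); first by rewrite subr_gt0.
move=> r reps k [F [nF /sup_dist_off_ltP[b [b0 br hkb]]]].
exists (E `|` F); split; first exact: null_setU.
apply/sup_dist_off_ltP; exists (a + b); split.
- exact: addr_ge0.
- by rewrite -ltrBrDl (lt_le_trans br).
- move=> x /not_orP[Ex Fx].
  by rewrite (le_trans (ler_distD (h x) _ _))// lerD ?fha ?hkb.
Qed.

End Umu.

(* An alias of the type of measurable functions, with the measure as a phantom
   argument: the topology below depends on mu. *)
Definition Umu_space (d : measure_display) (T : measurableType d) (R : realType)
  (mu : {measure set T -> \bar R}) : Type := {mfun T >-> R}.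

Section Umu_topology.
Context (d : measure_display) (T : measurableType d) (R : realType).
Variable mu : {measure set T -> \bar R}.
Local Notation X := (Umu_space mu).

HB.instance Definition _ := Choice.on X.
HB.instance Definition _ := isPointed.Build X (cst 0 : {mfun T >-> R}).

(* R^o only because isBaseTopological wants a pointed index type. *)
Definition Umu_base_dom : set (X * R^o)%type := [set fe | 0 < fe.2].
Definition Umu_base (fe : X * R^o) : set X := Umu_ball mu fe.1 fe.2.

Let base_cover : \bigcup_(fe in Umu_base_dom) Umu_base fe = setT.
Proof.
apply/seteqP; split=> // f _; exists (f, 1); first exact: ltr01.
exact/Umu_ball_center/ltr01.
Qed.

Let base_join (i j : X * R^o) (t : X) :
  Umu_base_dom i -> Umu_base_dom j -> Umu_base i t -> Umu_base j t ->
  exists k, [/\ Umu_base_dom k, Umu_base k t & Umu_base k `<=` Umu_base i `&` Umu_base j].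
Proof.
move=> _ _ /Umu_ball_sub[a a0 ia] /Umu_ball_sub[b b0 jb].
have m0 : 0 < Num.min a b by rewrite lt_min a0.
exists (t, Num.min a b); split => //; first exact: Umu_ball_center.
by move=> g tg; split; [apply: ia tg|apply: jb tg]; rewrite ge_min lexx ?orbT.
Qed.

HB.instance Definition _ :=
  isBaseTopological.Build X base_cover base_join.

Lemma nbhs_UmuP (f : X) (B : set X) :
  nbhs f B <-> exists2 eps : R, 0 < eps & Umu_ball mu f eps `<=` B.
Proof.
rewrite nbhsE; split.
- move=> [U [[D D0 UE] Uf] UB].
  move: Uf; rewrite -UE => -[[g e] Dge /Umu_ball_sub[r r0 rP]].
  exists r => // h hf; apply: UB; rewrite -UE; exists (g, e) => //.
  exact: rP hf.
- move=> [e e0 eB]; exists (Umu_ball mu f e) => //; split.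
  + exists [set (f, e)]; first by move=> _ ->.
    by rewrite bigcup_set1.
  + exact: Umu_ball_center.
Qed.

Definition zero_set (f : T -> R) : set T := [set x | f x = 0].

Definition M_F : set X :=
  [set f : {mfun T >-> R} | (mu (~` zero_set f) < +oo)%E].

Definition M_infty : set X :=
  [set f : {mfun T >-> R} |
    forall eps : R, 0 < eps -> (mu [set x | (eps <= `|f x|)%R] < +oo)%E].

End Umu_topology.

Arguments M_F {d T R} mu _.
Arguments M_infty {d T R} mu _.

(* Main.v *)
Require Import Defs.
From mathcomp Require Import all_boot all_order all_algebra.
From mathcomp Require Import all_classical all_reals all_analysis.
From mathcomp Require Import measurable_realfun.

(** To approximate [f] in [M_infty] within [eps], replace it by [0] where
    [`|f x| < eps / 2]: the result is supported on a set of finite measure.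
    Conversely, if [g] in [M_F] is within [eps] of [f] off a null set [E], then
    [`|f x| >= eps] forces [x] into [E] or into the support of [g]. *)

Import Order.TTheory GRing.Theory Num.Theory.

Local Open Scope classical_set_scope.
Local Open Scope ring_scope.

Section Umu_closure.
Context {d : measure_display} {T : measurableType d} {R : realType}.
Variable mu : {measure set T -> \bar R}.

Lemma measurable_level_ge (f : {mfun T >-> R}) (e : R) :
  measurable [set x | e <= `|f x|].
Proof.
have mf : measurable_fun setT (fun x => `|f x|) by exact: measurableT_comp.
rewrite [X in measurable X](_ : _ = setT `&` (fun x => `|f x|) @^-1` `[e, +oo[).
  exact: mf.
by apply/seteqP; split => x /=; rewrite in_itv/= andbT //; case.
Qed.

Lemma measurable_support (f : {mfun T >-> R}) : measurable (~` zero_set f).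
Proof.
apply: measurableC; rewrite (_ : zero_set f = setT `&` f @^-1` [set 0]).
  exact: measurable_funPT.
by rewrite setTI.
Qed.

(** By [nbhs_UmuP] the balls centred at [f] form a neighbourhood basis, so only these need to meet
    [A]. *)
Lemma closure_UmuP (A : set (Umu_space mu)) (f : Umu_space mu) :
  closure A f <-> forall e : R, 0 < e -> exists2 g, A g & Umu_ball mu f e g.
Proof.
split=> [clf e e0|Af B /nbhs_UmuP[e e0 eB]].
  have /clf[g [Ag fg]] : nbhs f (Umu_ball mu f e) by apply/nbhs_UmuP; exists e.
  by exists g.
by have [g Ag fg] := Af _ e0; exists g; split => //; exact: eB.
Qed.

Lemma M_F_dense_in_M_infty (f : Umu_space mu) (e : R) :
  M_infty mu f -> 0 < e -> exists2 g, M_F mu g & Umu_ball mu f e g.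
Proof.
move=> fM e0; have e20 : 0 < e / 2 by rewrite divr_gt0.
(* [F] is [f] seen at the type that carries the pointwise product used to define [g]. *)
pose F : {mfun T >-> R} := f.
pose A := [set x | e / 2 <= `|F x|].
have mA : measurable A by exact: measurable_level_ge.
pose g : {mfun T >-> R} := F * indic_mfun A mA.
have gE x : g x = F x * \1_A x by [].
exists g.
  (* [g] vanishes off [A], and [mu A] is finite by [fM] at [e / 2]. *)
  apply: (@le_lt_trans _ _ (mu A)); last exact: fM.
  apply: le_measure; rewrite ?inE//; first exact: measurable_support.
  move=> x gx0; apply: contrapT => nAx; apply: gx0.
  by have : g x = 0 by rewrite gE indicE memNset// mulr0.
exists set0; split; first by split => //; rewrite measure0.
(* The supremum must be strictly below [e]; truncating at level [e] would only bound it by [e],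
   hence the level [e / 2]. *)
apply/sup_dist_off_ltP; exists (e / 2); split; first exact: ltW.
  by rewrite ltr_pdivrMr// ltr_pMr// ltr1n.
move=> x _; rewrite -/(F x) -/(g x) gE indicE.
have [Ax|nAx] := pselect (A x).
  by rewrite mem_set// mulr1 subrr normr0 ltW.
by rewrite memNset// mulr0 subr0 leNgt; apply/negP => /ltW.
Qed.

(** Off [E] the distance is at most some [r < e], so a zero of [g] there forces [|f x| <= r < e]. *)
Lemma level_ge_sub_support (f g : {mfun T >-> R}) (e : R) :
  Umu_ball mu f e g ->
  exists2 E, Defs.null_set mu E & [set x | e <= `|f x|] `<=` ~` zero_set g `|` E.
Proof.
move=> [E [nE /sup_dist_off_ltP[r [_ re fgr]]]]; exists E => // x /= efx.
have [Ex|nEx] := pselect (E x); [by right|left => gx0].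
have := fgr x nEx; rewrite gx0 subr0 => /(le_trans efx).
by rewrite leNgt re.
Qed.

End Umu_closure.

Theorem theorem4p2 (d : measure_display) (T : measurableType d) (R : realType)
    (mu : {measure set T -> \bar R}) :
  M_infty mu = closure (M_F mu).
Proof.
apply/seteqP; split => f.
  by move=> fM; apply/closure_UmuP => e; exact: M_F_dense_in_M_infty.
move=> /closure_UmuP clf e e0.
have [g gF /level_ge_sub_support[E [mE E0] sub]] := clf e e0.
have mg := measurable_support g.
(* Adding the null set [E] to the support of [g] keeps its measure, so monotonicity applies to
   [sub]. *)
apply: le_lt_trans gF; rewrite -(measureU0 mg mE E0).
by apply: le_measure => //; rewrite inE;
  [exact: measurable_level_ge|exact: measurableU].
Qed.
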